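(* Let $V=\{v\in\mathbb{R}^n: Av\ge b\}$ be a non-empty bounded polyhedron, let $(x^i,c^i)_{i=1}^N$ be data with $x^i\in\mathbb{R}^K$, $c^i\in\mathbb{R}^n$, and let $m(\omega,x)\in\mathbb{R}^n$ be a parametric model with parameters $\omega$ ranging over a set $\Omega$. Then the pessimistic bilevel problem $$\min_{\omega\in\Omega}\ \max_{v^1,\dots,v^N}\ \frac1N\sum_{i\in[N]}c^{i\top}v^i\quad\text{s.t.}\quad v^i\in\arg\min_{\tilde v}\{m(\omega,x^i)^\top\tilde v:\ A\tilde v\ge b\}\quad\forall i\in[N]$$ is equivalent to the single-level problem $$\begin{aligned}\min_{\omega\in\Omega,\mu,\delta,\gamma}\ &\sum_{i\in[N]}\left(b^\top\mu^i+m(\omega,x^i)^\top\delta^i\right)\\ \text{s.t. }\ &A^\top\mu^i+m(\omega,x^i)\gamma^i=\tfrac1N c^i &&\forall i\in[N]\\ &A\delta^i-b\gamma^i\ge 0&&\forall i\in[N]\\ &\mu^i\le 0,\ \gamma^i\ge 0&&\forall i\in[N],\end{aligned}$$ in the sense that the two problems have the same optimal value (infimum), and $\omega$ is optimal for the first if and only if there exist $(\mu,\delta,\gamma)$ such that $(\omega,\mu,\delta,\gamma)$ is optimal for the second.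
   Context: $[N]=\{1,\dots,N\}$. If $A$ has $p$ rows, then $\mu^i\in\mathbb{R}^p$, $\delta^i\in\mathbb{R}^n$, $\gamma^i\in\mathbb{R}$. A solution $\omega\in\Omega$ of the first problem is optimal if it attains the outer minimum of the inner maximum value. *)

(* Defs.v *)
From mathcomp Require Import all_boot all_order all_algebra.
From mathcomp Require Import all_classical all_reals all_analysis.
Set Implicit Arguments.
Unset Strict Implicit.
Unset Printing Implicit Defensive.
Import Order.TTheory GRing.Theory Num.Theory.
Import numFieldNormedType.Exports.
Local Open Scope classical_set_scope.
Local Open Scope ring_scope.

(* Componentwise order; matrices carry no order in the library. *)
Definition vle (R : realType) (n : nat) (u v : 'cV[R]_n) : Prop :=
  forall i, u i 0 <= v i 0.

Definition dot (R : realType) (n : nat) (u v : 'cV[R]_n) : R :=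
  (u^T *m v) 0 0.

(* Minimizers of f over F. The order on Y is arbitrary, so that f may be
   real-valued or extended-real-valued. *)
Definition argmin (disp : Order.disp_t) (Y : porderType disp) (T : Type)
    (F : set T) (f : T -> Y) : set T :=
  [set s | F s /\ forall t, F t -> (f s <= f t)%O].

(* As usual, an infeasible minimization problem has infimum +oo (and an
   infeasible maximization problem has supremum -oo). *)
Definition inf_value (R : realType) (T : Type) (F : set T) (f : T -> \bar R)
  : \bar R := ereal_inf [set f s | s in F].

Definition sup_value (R : realType) (T : Type) (F : set T) (f : T -> \bar R)
  : \bar R := ereal_sup [set f s | s in F].

Definition polyhedron (R : realType) (p n : nat) (A : 'M[R]_(p, n))
    (b : 'cV[R]_p) : set 'cV[R]_n := [set v | vle b (A *m v)].

Section Problems.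
Variables (R : realType) (p n K N : nat) (W : Type).
Variables (A : 'M[R]_(p, n)) (b : 'cV[R]_p).
Variables (x : 'I_N -> 'cV[R]_K) (c : 'I_N -> 'cV[R]_n).
Variables (Omega : set W) (m : W -> 'cV[R]_K -> 'cV[R]_n).

Definition lower_level_feasible (w : W) : set ('I_N -> 'cV[R]_n) :=
  [set v | forall i, argmin (polyhedron A b) (dot (m w (x i))) (v i)].

Definition decision_cost (v : 'I_N -> 'cV[R]_n) : R :=
  N%:R^-1 * \sum_(i < N) dot (c i) (v i).

(* The objective that the bilevel problem minimizes over Omega. *)
Definition pessimistic_value (w : W) : \bar R :=
  sup_value (lower_level_feasible w) (fun v => (decision_cost v)%:E).

(* A quadruple (omega, mu, delta, gamma). *)
Definition single_level_var : Type :=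
  W * ('I_N -> 'cV[R]_p) * ('I_N -> 'cV[R]_n) * ('I_N -> R).

Definition single_level_feasible : set single_level_var :=
  [set s | let: (w, mu, delta, gamma) := s in
    Omega w /\
    forall i : 'I_N,
      [/\ A^T *m mu i + gamma i *: m w (x i) = N%:R^-1 *: c i,
          vle 0 (A *m delta i - gamma i *: b),
          vle (mu i) 0
        & 0 <= gamma i]].

Definition single_level_cost (s : single_level_var) : \bar R :=
  let: (w, mu, delta, gamma) := s in
  (\sum_(i < N) (dot b (mu i) + dot (m w (x i)) (delta i)))%:E.

End Problems.

(* Main.v *)
Require Import Defs.
From mathcomp Require Import all_boot all_order all_algebra.
From mathcomp Require Import all_classical all_reals all_analysis.
From mathcomp Require Import ring lra.
Import Order.TTheory GRing.Theory Num.Theory.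
Import numFieldNormedType.Exports.
Local Open Scope classical_set_scope.
Local Open Scope ring_scope.

(** The problems decouple over the scenarios once [omega] is fixed. In each
    scenario, with lower-level cost [f], weak duality says that a feasible
    [(mu, delta, gamma)] bounds [c^i^T v / N] from above for every lower-level
    optimal [v]. Conversely, if [v0] is lower-level optimal, then maximizing
    [c^i^T v / N] over [A v >= b], [f^T v <= f^T v0] is a linear program; an
    optimal dual solution [(mu, gamma)] together with [delta := gamma v0] is
    feasible for the single-level problem and attains the maximum. The linear
    programs are feasible, and their duals are feasible because a bounded
    polyhedron has no nonzero recession direction (by Farkas' lemma). Hence the
    pessimistic value at [omega] is the minimum of the single-level cost over
    [(mu, delta, gamma)]. *)

(** * Inner products and the componentwise order *)

Section Dot.
Set Implicit Arguments.
Unset Strict Implicit.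
Context {R : realType}.

Lemma dotE {n} (u v : 'cV[R]_n) : dot u v = \sum_i u i 0 * v i 0.
Proof. by rewrite /dot mxE; apply: eq_bigr => i _; rewrite mxE. Qed.

Lemma dotC {n} (u v : 'cV[R]_n) : dot u v = dot v u.
Proof. by rewrite !dotE; apply: eq_bigr => i _; rewrite mulrC. Qed.

Lemma dotDr {n} (u v w : 'cV[R]_n) : dot u (v + w) = dot u v + dot u w.
Proof. by rewrite /dot mulmxDr mxE. Qed.

Lemma dotZr {n} a (u v : 'cV[R]_n) : dot u (a *: v) = a * dot u v.
Proof. by rewrite /dot -scalemxAr mxE. Qed.

Lemma dotNr {n} (u v : 'cV[R]_n) : dot u (- v) = - dot u v.
Proof. by rewrite /dot mulmxN mxE. Qed.

Lemma dot0r {n} (u : 'cV[R]_n) : dot u 0 = 0.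
Proof. by rewrite /dot mulmx0 mxE. Qed.

Lemma dotDl {n} (u v w : 'cV[R]_n) : dot (v + w) u = dot v u + dot w u.
Proof. by rewrite dotC dotDr !(dotC u). Qed.

Lemma dotZl {n} a (u v : 'cV[R]_n) : dot (a *: u) v = a * dot u v.
Proof. by rewrite dotC dotZr dotC. Qed.

Lemma dotNl {n} (u v : 'cV[R]_n) : dot (- u) v = - dot u v.
Proof. by rewrite dotC dotNr dotC. Qed.

Lemma dot0l {n} (u : 'cV[R]_n) : dot 0 u = 0.
Proof. by rewrite dotC dot0r. Qed.

Lemma dot_trmul {p n} (A : 'M[R]_(p, n)) u v :
  dot (A^T *m u) v = dot u (A *m v).
Proof. by rewrite /dot trmx_mul trmxK mulmxA. Qed.

Lemma dot_col_mx {p q} (u1 v1 : 'cV[R]_p) (u2 v2 : 'cV[R]_q) :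
  dot (col_mx u1 u2) (col_mx v1 v2) = dot u1 v1 + dot u2 v2.
Proof. by rewrite /dot tr_col_mx mul_row_col mxE. Qed.

Lemma dot_cV1 (u v : 'cV[R]_1) : dot u v = u 0 0 * v 0 0.
Proof. by rewrite dotE big_ord1. Qed.

Lemma mul_tr_dot {n} (u v : 'cV[R]_n) : u^T *m v = (dot u v)%:M.
Proof. exact: mx11_scalar. Qed.

Lemma dot_self_eq0 {n} (u : 'cV[R]_n) : dot u u <= 0 -> u = 0.
Proof.
rewrite dotE => le0; have sq_ge0 i : true -> 0 <= u i 0 * u i 0.
  by rewrite -expr2 sqr_ge0.
have /eqP : \sum_i u i 0 * u i 0 = 0 by apply/le_anti; rewrite le0 sumr_ge0.
rewrite psumr_eq0// => /allP u0; apply/matrixP => i j.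
have /implyP/(_ isT) := u0 i (mem_index_enum i).
by rewrite mulf_eq0 orbb => /eqP; rewrite ord1 mxE.
Qed.

Lemma dot_le {n} (u v w : 'cV[R]_n) :
  vle 0 u -> vle v w -> dot u v <= dot u w.
Proof.
move=> u0 vw; rewrite !dotE ler_sum// => i _.
by rewrite ler_wpM2l//; move: (u0 i); rewrite mxE.
Qed.

Lemma vle_col_mx {p q} (u1 v1 : 'cV[R]_p) (u2 v2 : 'cV[R]_q) :
  vle (col_mx u1 u2) (col_mx v1 v2) <-> vle u1 v1 /\ vle u2 v2.
Proof.
split=> [le12|[le1 le2] i].
  split=> i.
    by have := le12 (lshift q i); rewrite !col_mxEu.
  by have := le12 (rshift p i); rewrite !col_mxEd.
rewrite -[i]splitK; case: fintype.split => j /=.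
  by rewrite !col_mxEu.
by rewrite !col_mxEd.
Qed.

Lemma vle_scalar (a b : R) : vle (a%:M : 'cV_1) b%:M <-> a <= b.
Proof.
split=> [/(_ 0)|ab i]; first by rewrite !mxE.
by rewrite !mxE ord1.
Qed.

Lemma vleN {n} (u v : 'cV[R]_n) : vle (- u) (- v) <-> vle v u.
Proof. by split=> + i => /(_ i); rewrite !mxE lerN2. Qed.

Lemma vle_subr {n} (u v : 'cV[R]_n) : vle (u - v) 0 <-> vle u v.
Proof. by split=> + i => /(_ i); rewrite !mxE subr_le0. Qed.

Lemma vle_subl {n} (u v : 'cV[R]_n) : vle 0 (v - u) <-> vle u v.
Proof. by split=> + i => /(_ i); rewrite !mxE subr_ge0. Qed.

Lemma vleZ {n} a (u v : 'cV[R]_n) : 0 <= a -> vle u v -> vle (a *: u) (a *: v).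
Proof. by move=> a0 uv i; rewrite !mxE ler_wpM2l. Qed.

Lemma vleD {n} (u v u' v' : 'cV[R]_n) :
  vle u v -> vle u' v' -> vle (u + u') (v + v').
Proof. by move=> uv uv' i; rewrite !mxE lerD. Qed.

Lemma vle_refl {n} (u : 'cV[R]_n) : vle u u.
Proof. by move=> i. Qed.

End Dot.

(** * Farkas' lemma, Gale's alternative and linear programming duality *)

Section LinearProgramming.
Set Implicit Arguments.
Unset Strict Implicit.
Context {R : realType}.

(* Bartl's induction: if the last constraints alone do not imply the
   conclusion, a violating point [x0] serves to project along the first. *)
Lemma farkas {p n} (M : 'M[R]_(p, n)) (g : 'cV[R]_n) :
  (forall z, vle (M *m z) 0 -> dot g z <= 0) ->
  exists2 u, vle 0 u & M^T *m u = g.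
Proof.
elim: p M g => [|p IH] M g Mg.
  exists 0; first exact: vle_refl.
  (* With no constraints, the hypothesis applies to [z = g] itself. *)
  by rewrite mulmx0 [RHS]dot_self_eq0//; apply: Mg => -[].
rewrite -[p.+1]/(1 + p)%N in M Mg *.
pose a : 'cV_n := (usubmx M)^T; pose M' := dsubmx M.
have ME : M = col_mx a^T M' by rewrite trmxK vsubmxK.
have Mle z : dot a z <= 0 -> vle (M' *m z) 0 -> vle (M *m z) 0.
  move=> az M'z; rewrite ME mul_col_mx -[X in vle _ X]col_mx0.
  by rewrite vle_col_mx; split=> // i; rewrite !ord1 [X in _ <= X]mxE.
have [M'g|] := pselect (forall z, vle (M' *m z) 0 -> dot g z <= 0).
  have [u u0 M'u] := IH _ _ M'g; exists (col_mx 0 u).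
    by rewrite -col_mx0 vle_col_mx; split=> //; exact: vle_refl.
  by rewrite ME tr_col_mx mul_row_col mulmx0 add0r.
move=> /existsNP[x0 /not_implyP[M'x0 /negP]]; rewrite -ltNge => gx0.
have ax0 : 0 < dot a x0.
  by rewrite ltNge; apply/negP => /Mle/(_ M'x0)/Mg; rewrite leNgt gx0.
pose k := dot a x0; have k0 : k != 0 by rewrite gt_eqF.
(* The new rows and goal are the old ones composed with [y = z - (dot a z / k) *: x0], the
   projection along [x0] onto the kernel of [a]. *)
have [|u u0 M''u] :=
    IH (M' - k^-1 *: (M' *m x0 *m a^T)) (g - (dot g x0 / k) *: a).
  move=> z M''z; pose y := z - (dot a z / k) *: x0.
  have -> : dot (g - (dot g x0 / k) *: a) z = dot g y.
    by rewrite dotDl dotDr dotNl dotNr dotZl dotZr; field.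
  apply/Mg/Mle; first by rewrite dotDr dotNr dotZr divfK// subrr.
  move: M''z; rewrite mulmxBl -scalemxAl -(mulmxA (M' *m x0)).
  rewrite mul_tr_dot mul_mx_scalar.
  by rewrite mulmxBr -scalemxAr scalerA mulrC.
(* The total coefficient of [a] once the projection is expanded; its sign follows from
   [dot g x0 > 0], [M' *m x0 <= 0] and [k > 0]. *)
pose s := dot g x0 / k - k^-1 * dot (M' *m x0) u.
exists (col_mx s%:M u).
  rewrite -col_mx0 vle_col_mx; split=> // i; rewrite !ord1 !mxE mulr1n.
  have : dot u (M' *m x0) <= 0 by rewrite -[leRHS](dot0r u); exact: dot_le.
  rewrite /s dotC [_ / k]mulrC -mulrBr => le0.
  by rewrite mulr_ge0 ?invr_ge0 ?(ltW ax0)// subr_ge0 (le_trans le0)// ltW.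
rewrite ME tr_col_mx mul_row_col trmxK mul_mx_scalar.
move: M''u; rewrite linearB /= linearZ /= mulmxBl -scalemxAl trmx_mul trmxK.
rewrite -mulmxA mul_tr_dot mul_mx_scalar scalerA => /eqP.
rewrite subr_eq => /eqP ->.
by apply/matrixP => i j; rewrite /s !mxE; ring.
Qed.

Arguments farkas {p n} M g _.

(** Homogenization: a pair [(x, t)] with [M *m x <= t *: q] and [t > 0] would rescale to a solution,
    so Farkas' lemma applies with goal [t <= 0]. *)
Lemma gale {p n} (M : 'M[R]_(p, n)) (q : 'cV[R]_p) :
  ~ (exists z, vle (M *m z) q) ->
  exists u, [/\ vle 0 u, M^T *m u = 0 & dot q u < 0].
Proof.
move=> Mq.
have [|u] := farkas (block_mx M (- q) 0 (- 1%:M : 'M[R]_1)) (col_mx 0 1%:M).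
  move=> z; rewrite -[z]vsubmxK; set x := usubmx z; set t := dsubmx z.
  rewrite mul_block_col dot_col_mx dot0l add0r dot_cV1 mxE mulr1n mul1r.
  rewrite -[X in vle _ X]col_mx0 vle_col_mx (mx11_scalar t) => -[le1 _].
  rewrite mxE mulr1n leNgt; apply/negP => t0; apply: Mq.
  exists ((t 0 0)^-1 *: x); move: le1; rewrite mul_mx_scalar scalerN vle_subr.
  have t0' : 0 <= (t 0 0)^-1 by rewrite invr_ge0 ltW.
  by move=> /(vleZ t0'); rewrite scalerA mulVf ?gt_eqF// scale1r scalemxAr.
rewrite -[u]vsubmxK; set y := usubmx u; set s := dsubmx u.
rewrite -col_mx0 vle_col_mx tr_block_mx mul_block_col => -[y0 s0].
move=> /eq_col_mx[]; rewrite trmx0 mul0mx addr0 => My e; exists y; split=> //.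
have {}e : - dot q y - s 0 0 = 1.
  move: e => /matrixP/(_ 0 0); rewrite !linearN /= trmx1 !mulNmx mul1mx.
  by rewrite mul_tr_dot !mxE.
by have := s0 0; rewrite mxE => ?; lra.
Qed.

Lemma lp_weak_duality {p n} (M : 'M[R]_(p, n)) (q : 'cV[R]_p) x y :
  vle (M *m x) q -> vle 0 y -> dot (M^T *m y) x <= dot q y.
Proof. by move=> Mx y0; rewrite dot_trmul (dotC q); exact: dot_le. Qed.

(** Primal feasibility, dual feasibility and the reversed duality inequality form one linear system
    in [(x, y)], encoded by [S] and [r]. A Gale certificate of its infeasibility would contradict
    weak duality. *)
Lemma lp_strong_duality {p n} (M : 'M[R]_(p, n)) (q : 'cV[R]_p)
    (g : 'cV[R]_n) :
  (exists x, vle (M *m x) q) -> (exists2 y, vle 0 y & M^T *m y = g) ->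
  exists x y, [/\ vle (M *m x) q, vle 0 y, M^T *m y = g & dot q y <= dot g x].
Proof.
move=> [x1 Mx1] [y1 y1_0 My1].
pose S : 'M[R]_(p + (n + (n + (p + 1))), n + p) :=
  col_mx (row_mx M 0) (col_mx (row_mx 0 M^T) (col_mx (row_mx 0 (- M^T))
    (col_mx (row_mx 0 (- 1%:M)) (row_mx (- g^T) q^T)))).
pose r : 'cV[R]_(p + (n + (n + (p + 1)))) :=
  col_mx q (col_mx g (col_mx (- g) 0)).
have [[z]|/gale[u]] := pselect (exists z, vle (S *m z) r).
  rewrite -[z]vsubmxK; set x := usubmx z; set y := dsubmx z.
  rewrite /S !mul_col_mx !mul_row_col !mul0mx addr0 !add0r /r -col_mx0.
  rewrite !vle_col_mx !mulNmx mul1mx !mul_tr_dot.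
  move=> [Mx [My [/vleN My' [y0 le]]]]; exists x, y; split=> //.
  - by apply/vleN; rewrite oppr0.
  - apply/matrixP => i j; rewrite !ord1; apply/le_anti.
    by rewrite My My'.
  - by have := le 0; rewrite !mxE !mulr1n addrC subr_le0.
rewrite -[u]vsubmxK; set u1 := usubmx u; rewrite -[dsubmx u]vsubmxK.
set u2 := usubmx (dsubmx u); rewrite -[dsubmx (dsubmx u)]vsubmxK.
set u3 := usubmx _; rewrite -[dsubmx (dsubmx (dsubmx u))]vsubmxK.
set u4 := usubmx (dsubmx _); set u5 := dsubmx (dsubmx (dsubmx (dsubmx u))).
case=> u0 Su lt0.
move: u0; rewrite -!col_mx0 !vle_col_mx => -[u1_0 [_ [_ [u4_0 u5_0]]]].
move: lt0; rewrite /r !dot_col_mx dot0l addr0 => lt0.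
move: Su; rewrite /S !tr_col_mx !mul_row_col !tr_row_mx !mul_col_mx !linearN /=.
rewrite !trmx0 !mul0mx !trmx1 !trmxK !add_col_mx !mulNmx mul1mx.
rewrite (mx11_scalar u5) !mul_mx_scalar; pose t : R := u5 0 0; rewrite -/t.
rewrite -col_mx0 => /eq_col_mx[].
rewrite !add0r => /subr0_eq Mu1 e.
have t0 : 0 <= t by have := u5_0 0; rewrite mxE.
(* The certificate yields a primal point [h] for [t *: q] and a dual point [u1] for [t *: g], with a
   strictly violated duality inequality. *)
pose h := u3 - u2.
have Mh : vle (M *m h) (t *: q).
  rewrite -vle_subl (_ : _ - _ = u4)//.
  rewrite /h mulmxBr; apply/eqP; rewrite -subr_eq0 -[X in _ == X]e; apply/eqP.
  by apply/matrixP => i j; rewrite !mxE; ring.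
have lth : dot q u1 < dot g h.
  by rewrite /h dotDr dotNr; move: lt0; rewrite dotNl => ?; lra.
(* If [t = 0], pairing [u1] with [x1] and [h] with [y1] gives [dot g h <= 0 <= dot q u1]. If
   [t > 0], [u1] is paired with [h] and [t] cancels. *)
have := t0; rewrite le_eqVlt => /predU1P[t_eq0|t_gt0].
  have := lp_weak_duality Mx1 u1_0; rewrite Mu1 -t_eq0 scale0r dot0l.
  have := lp_weak_duality Mh y1_0; rewrite My1 -t_eq0 scale0r dot0l.
  move=> gh qu; have := le_lt_trans qu (lt_le_trans lth gh).
  by rewrite ltxx.
have := lp_weak_duality Mh u1_0; rewrite Mu1 !dotZl ler_pM2l//.
by rewrite leNgt lth.
Qed.

End LinearProgramming.

Arguments farkas {R p n} M g _.
Arguments lp_strong_duality {R p n} M q g _ _.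

(** * Bounded polyhedra and duality within one scenario *)

Section BoundedPolyhedron.
Set Implicit Arguments.
Unset Strict Implicit.
Context {R : realType} {p n : nat} (A : 'M[R]_(p, n)) (b : 'cV[R]_p).
Hypotheses (V0 : polyhedron A b !=set0) (Vb : bounded_set (polyhedron A b)).

Lemma bounded_recession_eq0 d : vle 0 (A *m d) -> d = 0.
Proof.
move=> Ad; apply/eqP; rewrite -normr_le0 leNgt; apply/negP => d0.
have [v Vv] := V0; have [B [_ /(_ (B + 1))]] := Vb.
rewrite ltrDl ltr01 => /(_ isT) VB.
(* Far enough along the ray from [v] that [v + t *: d] has norm greater than [B + 1]. *)
pose t := (`|v| + `|B + 1| + 1) / `|d|.
have t0 : 0 <= t by rewrite divr_ge0// !addr_ge0.
have /VB /= : polyhedron A b (v + t *: d).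
  rewrite /polyhedron /= mulmxDr -scalemxAr -[b]addr0.
  by apply: vleD => //; rewrite -(scaler0 _ t); exact: vleZ.
have : `|t *: d| <= `|v + t *: d| + `|v|.
  by rewrite -{1}[t *: d](addKr v) addrC (le_trans (ler_normB _ _)).
rewrite normrZ (ger0_norm t0) /t divfK ?gt_eqF//.
by have := ler_norm (B + 1) => *; lra.
Qed.

(** Farkas' condition need only be checked on recession directions, and the only one is zero. *)
Lemma bounded_dual_feasible g : exists2 y, vle 0 y & A^T *m y = g.
Proof.
have [z|y y0 Ay] := farkas (- A) (- g).
  rewrite mulNmx -[X in vle _ X]oppr0 vleN => /bounded_recession_eq0 ->.
  by rewrite dot0r.
by exists y => //; move: Ay; rewrite linearN mulNmx => /oppr_inj.
Qed.

(** Existence comes from strong duality rather than compactness; the sign changes turn minimization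
    over [A v >= b] into the maximization form. *)
Lemma polyhedron_argmin f : argmin (polyhedron A b) (dot f) !=set0.
Proof.
have [v Vv] := V0; have [y y0 Ay] := bounded_dual_feasible f.
have [||x [z [Ax z0 Az le]]] := lp_strong_duality (- A) (- b) (- f).
- by exists v; rewrite mulNmx vleN.
- by exists y => //; rewrite linearN mulNmx Ay.
exists x; split=> [|u Vu]; first by move: Ax; rewrite mulNmx vleN.
have Vu' : vle (- A *m u) (- b) by rewrite mulNmx vleN.
have := lp_weak_duality Vu' z0; rewrite Az.
by move: le; rewrite !dotNl => *; lra.
Qed.

(* The point [(v + delta) / (1 + gamma)] lies in the polyhedron, whether or not
   [gamma] vanishes, so that optimality of [v] gives
   [gamma * dot f v <= dot f delta]. *)
Lemma scenario_weak_duality f g v mu delta gamma :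
  argmin (polyhedron A b) (dot f) v ->
  A^T *m mu + gamma *: f = g -> vle 0 (A *m delta - gamma *: b) ->
  vle mu 0 -> 0 <= gamma ->
  dot g v <= dot b mu + dot f delta.
Proof.
move=> [Vv vmin] <- /vle_subl Ad mu0 ga0.
have ga1 : 0 < 1 + gamma by rewrite ltr_wpDr.
have Vu : polyhedron A b ((1 + gamma)^-1 *: (v + delta)).
  rewrite /polyhedron /= -scalemxAr mulmxDr.
  rewrite -[b](@scalerK _ _ (1 + gamma)) ?gt_eqF//.
  apply: vleZ; first by rewrite invr_ge0 ltW.
  by rewrite scalerDl scale1r; exact: vleD.
have := vmin _ Vu; rewrite dotZr ler_pdivlMl// dotDr dotDl dotZl dot_trmul => le.
have : dot (- mu) b <= dot (- mu) (A *m v).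
  by apply: dot_le => //; rewrite -oppr0 vleN.
by rewrite !dotNl (dotC b) => ?; lra.
Qed.

(* Once a minimizer [v0] is known, the argmin is cut out of the polyhedron by
   the single inequality [dot f v <= dot f v0]; [gamma] is its multiplier. *)
Lemma scenario_strong_duality f g : exists v mu delta gamma,
  [/\ argmin (polyhedron A b) (dot f) v,
      [/\ A^T *m mu + gamma *: f = g, vle 0 (A *m delta - gamma *: b),
          vle mu 0 & 0 <= gamma]
    & dot b mu + dot f delta = dot g v].
Proof.
have [v0 [Vv0 v0min]] := polyhedron_argmin f.
have [y y0 Ay] := bounded_dual_feasible (- g).
pose M := col_mx (- A) f^T; pose q := col_mx (- b) (dot f v0)%:M.
have Mle v : vle (M *m v) q <-> polyhedron A b v /\ dot f v <= dot f v0.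
  rewrite /M /q mul_col_mx vle_col_mx mulNmx vleN mul_tr_dot.
  by rewrite vle_scalar.
have [||v [z [/Mle[Vv lev] z0 Mz le]]] := lp_strong_duality M q g.
- by exists v0; apply/Mle.
- exists (col_mx y 0).
    by rewrite -col_mx0 vle_col_mx; split=> //; exact: vle_refl.
  by rewrite tr_col_mx mul_row_col mulmx0 addr0 linearN mulNmx Ay opprK.
have vmin : argmin (polyhedron A b) (dot f) v.
  by split=> // u /v0min; exact: le_trans.
move: z0 Mz le; rewrite -[z]vsubmxK; set mu := usubmx z.
rewrite (mx11_scalar (dsubmx z)); set gamma := dsubmx z 0 0.
rewrite -col_mx0 vle_col_mx tr_col_mx mul_row_col dot_col_mx trmxK.
rewrite mul_mx_scalar dot_cV1 !mxE !mulr1n linearN mulNmx.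
move=> [mu0 ga0] Mz le.
have {}ga0 : 0 <= gamma by have := ga0 0; rewrite !mxE mulr1n.
have fe : A^T *m (- mu) + gamma *: f = g by rewrite mulmxN.
have fd : vle 0 (A *m (gamma *: v0) - gamma *: b).
  by rewrite vle_subl -scalemxAr; exact: vleZ.
have fm : vle (- mu) 0 by rewrite -oppr0 vleN.
exists v, (- mu), (gamma *: v0), gamma; split=> //.
apply/le_anti; rewrite (scenario_weak_duality vmin fe fd fm ga0) andbT.
by rewrite dotZr dotNr; move: le; rewrite dotNl => ?; lra.
Qed.

End BoundedPolyhedron.

(** * Assembling the scenarios *)

Section Equivalence.
Set Implicit Arguments.
Unset Strict Implicit.
Context {R : realType} {p n K N : nat} {W : Type}.
Context (A : 'M[R]_(p, n)) (b : 'cV[R]_p).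
Hypotheses (V0 : polyhedron A b !=set0) (Vb : bounded_set (polyhedron A b)).
Context (x : 'I_N -> 'cV[R]_K) (c : 'I_N -> 'cV[R]_n).
Context (Omega : set W) (m : W -> 'cV[R]_K -> 'cV[R]_n).

(** Moving the weight [1/N] onto [c i] matches the right-hand side of the single-level equality
    constraint. *)
Lemma decision_costE v :
  decision_cost c v = \sum_(i < N) dot (N%:R^-1 *: c i) (v i).
Proof. by rewrite /decision_cost mulr_sumr; under eq_bigr do rewrite -dotZl. Qed.

Lemma pessimistic_value_le s : single_level_feasible A b x c Omega m s ->
  (pessimistic_value A b x c m s.1.1.1 <= single_level_cost b x m s)%E.
Proof.
case: s => -[[w mu] delta] gamma /= [_ feas]; apply: ge_ereal_sup => _ [v lv <-].
rewrite lee_fin decision_costE ler_sum// => i _.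
by have [? ? ? ?] := feas i; apply: scenario_weak_duality (lv i) _ _ _ _; eauto.
Qed.

Lemma pessimistic_value_attained w : Omega w -> exists mu delta gamma,
  single_level_feasible A b x c Omega m (w, mu, delta, gamma) /\
  single_level_cost b x m (w, mu, delta, gamma) = pessimistic_value A b x c m w.
Proof.
move=> Ow.
have sol i := scenario_strong_duality V0 Vb (m w (x i)) (N%:R^-1 *: c i).
have [v /choice[mu /choice[delta /choice[gamma opt]]]] := choice sol.
have feas : single_level_feasible A b x c Omega m (w, mu, delta, gamma).
  by split=> // i; have [] := opt i.
exists mu, delta, gamma; split=> //; apply/le_anti.
rewrite (pessimistic_value_le feas) andbT.
apply: ereal_sup_ubound; exists v; first by move=> i; have [] := opt i.
rewrite decision_costE /=; congr _%:E; apply: eq_bigr => i _.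
by have [] := opt i.
Qed.

End Equivalence.

Theorem mainTheorem5 (R : realType) (p n K N : nat) (hN : (0 < N)%N)
    (A : 'M[R]_(p, n)) (b : 'cV[R]_p)
    (hV0 : polyhedron A b !=set0)
    (hVb : bounded_set (polyhedron A b))
    (x : 'I_N -> 'cV[R]_K) (c : 'I_N -> 'cV[R]_n)
    (W : Type) (Omega : set W) (m : W -> 'cV[R]_K -> 'cV[R]_n) :
  inf_value Omega (pessimistic_value A b x c m) =
    inf_value (single_level_feasible A b x c Omega m)
              (single_level_cost b x m)
  /\
  forall w : W,
    argmin Omega (pessimistic_value A b x c m) w <->
    exists (mu : 'I_N -> 'cV[R]_p) (delta : 'I_N -> 'cV[R]_n)
           (gamma : 'I_N -> R),
      argmin (single_level_feasible A b x c Omega m)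
             (single_level_cost b x m) (w, mu, delta, gamma).
Proof.
(* What remains is partial minimization: [le] bounds the cost from below at feasible points, and
   [att] reaches that bound over each [w] in [Omega]. *)
have le s := @pessimistic_value_le R p n K N W A b x c Omega m s.
have att := @pessimistic_value_attained R p n K N W A b hV0 hVb x c Omega m.
have inO s : single_level_feasible A b x c Omega m s -> Omega s.1.1.1.
  by case: s => -[[? ?] ?] ? [].
split.
  apply/le_anti/andP; split; apply: le_ereal_inf_tmp => y [].
    move=> s fs <-; apply: le_trans (le s fs).
    by apply: ereal_inf_lbound; exists s.1.1.1 => //; exact: inO.
  move=> w /att[mu [delta [gamma [fs <-]]]] <-.
  by apply: ereal_inf_lbound; exists (w, mu, delta, gamma).
move=> w; split=> [[Ow wmin]|[mu [delta [gamma [fs smin]]]]].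
  have [mu [delta [gamma [fs e]]]] := att w Ow.
  exists mu, delta, gamma; split=> // s fs'; rewrite e.
  exact: le_trans (wmin _ (inO s fs')) (le s fs').
split=> [|w' /att[mu' [delta' [gamma' [fs' <-]]]]]; first exact: inO fs.
exact: le_trans (le _ fs) (smin _ fs').
Qed.
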